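(* Let $(T,\mathcal{G})$ be a Hausdorff topological space, let $M\subset\mathfrak{RM}_b(T,\mathcal{G})$, and let $\operatorname{cl}M$ be the closure of $M$ in the weak topology $\mathcal{G}_w(\mathfrak{RM}_b(T,\mathcal{G}),S(T,\mathcal{G}))$. Suppose that $M$ has the following two properties: $(\alpha^{\zeta}_{var})$ for every $G\in\mathcal{G}$ and every $\varepsilon>0$ there is a compact set $C\subset G$ such that $|\mu|(G\setminus C)<\varepsilon$ for every $\mu\in M$; $(\beta_{var})$ $\sup\{|\mu|(T)\mid\mu\in M\}<\infty$. Then $\operatorname{cl}M$ is compact in the topology induced on it by $\mathcal{G}_w(\mathfrak{RM}_b(T,\mathcal{G}),S(T,\mathcal{G}))$.
   Context: $\mathcal{G}$ is the family of open subsets of $T$, and $\mathcal{B}$ is the Borel $\sigma$-algebra. A bounded (signed, real-valued, countably additive) measure $\mu:\mathcal{B}\to\mathbb{R}$ is a bounded Radon measure if for every $B\in\mathcal{B}$ and every $\varepsilon>0$ there is a compact $C\subset B$ with $|\mu B-\mu C|<\varepsilon$. $\mathfrak{RM}_b(T,\mathcal{G})$ is the linear space of all bounded Radon measures. For $\mu\in\mathfrak{RM}_b(T,\mathcal{G})$, $\mu_+=\mu\vee 0$, $\mu_-=\mu\wedge 0$, and $|\mu|=\mu_+-\mu_-$ is the total variation measure. A function $f:T\to\mathbb{R}$ is symmetrizable if for every $\varepsilon>0$ there is a finite cover $(K_i)_{i\in I}$ of $T$ by sets of the form $K_i=G_i\cap F_i$ with $G_i$ open and $F_i$ closed such that $\sup\{|f(s)-f(t)|\mid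 s,t\in K_i\}<\varepsilon$ for every $i\in I$. $S(T,\mathcal{G})$ is the linear space of all symmetrizable functions on $T$; every such function is bounded and integrable with respect to every bounded Radon measure, where $\int f\,d\mu=\int f\,d\mu_+-\int f\,d(-\mu_-)$. The weak topology $\mathcal{G}_w(\mathfrak{RM}_b(T,\mathcal{G}),S(T,\mathcal{G}))$ is the topology on $\mathfrak{RM}_b(T,\mathcal{G})$ generated by the seminorms $\mu\mapsto|\int f\,d\mu|$, $f\in S(T,\mathcal{G})$: a neighbourhood base at $\mu$ consists of the sets $\{\nu\mid|\int f_k\,d\nu-\int f_k\,d\mu|<\varepsilon\ \text{for all }k\}$ for finite families $(f_k)$ in $S(T,\mathcal{G})$ and $\varepsilon>0$. Compact means: Hausdorff and every open cover has a finite subcover. *)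

(* Defs.v *)
From HB Require Import structures.
From mathcomp Require Import all_boot all_order all_algebra.
From mathcomp Require Import all_classical all_reals all_analysis.

Set Implicit Arguments.
Unset Strict Implicit.
Unset Printing Implicit Defensive.

Import Order.TTheory GRing.Theory Num.Theory.
Import numFieldNormedType.Exports.

Local Open Scope classical_set_scope.
Local Open Scope ring_scope.

Definition borel (T : ptopologicalType) := g_sigma_algebraType (@open T).

Section jordan.
Context (R : realType) d (T : measurableType d).
Variable mu : {charge set T -> \bar R}.

Let hahn_posE := cid (Hahn_decomposition mu).
Let hahn_negE := cid (svalP hahn_posE).

(* By Hahn_decomposition_uniq the values below on measurable sets do not
   depend on the chosen Hahn decomposition. *)
Definition mu_hahn : hahn_decomposition mu (sval hahn_posE) (sval hahn_negE) :=
  svalP hahn_negE.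

(* charge_pos mu is the lattice supremum of mu and 0; charge_neg mu is the
   OPPOSITE of the lattice infimum of mu and 0, i.e. a nonnegative measure. *)
Definition charge_pos : {measure set T -> \bar R} := jordan_pos mu_hahn.
Definition charge_neg : {measure set T -> \bar R} := jordan_neg mu_hahn.
Definition charge_tv : set T -> \bar R := charge_variation mu_hahn.

Definition charge_integral (f : T -> R) : R :=
  \int[charge_pos]_x f x - \int[charge_neg]_x f x.

End jordan.

(* A charge is a function on all subsets, its values outside the
   sigma-algebra being unconstrained; brm_out normalizes them to 0, so that
   the elements of this type correspond exactly to real-valued set functions
   on the Borel sets, and equality is equality on the Borel sets. *)
Record bounded_radon_measure (R : realType) (T : ptopologicalType) := BRM {
  brm_charge :> {charge set (borel T) -> \bar R} ;
  brm_out : forall A : set (borel T), ~ measurable A -> brm_charge A = 0%E ;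
  brm_radon : forall (B : set (borel T)) (e : R), measurable B -> 0 < e ->
    exists C : set T, [/\ compact C, C `<=` B &
      (`|brm_charge B - brm_charge C| < e%:E)%E] }.

HB.instance Definition _ R T := gen_eqMixin (bounded_radon_measure R T).
HB.instance Definition _ R T := gen_choiceMixin (bounded_radon_measure R T).

(* The supremum is taken in \bar R, so empty pieces impose no constraint. *)
Definition symmetrizable (R : realType) (T : topologicalType) (f : T -> R) :=
  forall e : R, 0 < e ->
  exists (n : nat) (G F : 'I_n -> set T),
    [/\ forall i, open (G i), forall i, closed (F i),
        \bigcup_i (G i `&` F i) = setT &
        forall i, (ereal_sup [set `|f s - f t|%:E | s in G i `&` F i
                                                  & t in G i `&` F i]
                   < e%:E)%E].

Section weak_topology.
Context (R : realType) (T : ptopologicalType).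
Local Notation RMb := (bounded_radon_measure R T).

Definition weak_ball (mu : RMb) (S : set (T -> R)) (e : R) : set RMb :=
  [set nu : RMb |
    forall f, S f -> `|charge_integral nu f - charge_integral mu f| < e].

Definition weak_nbhs (mu : RMb) : set_system RMb :=
  [set A | exists (S : set (T -> R)) (e : R),
    [/\ finite_set S, S `<=` @symmetrizable R T, 0 < e &
        weak_ball mu S e `<=` A]].

HB.instance Definition _ := hasNbhs.Build RMb weak_nbhs.

Let weak_nbhs_filter (mu : RMb) : ProperFilter (nbhs mu).
Proof.
have center S e : 0 < e -> weak_ball mu S e mu.
  by move=> e0 f _; rewrite subrr normr0.
apply: Build_ProperFilter_ex.
  by move=> A [S [e [_ _ e0 SA]]]; exists mu; apply: SA; exact: center.
split.
- exists set0, 1; split => //.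
- move=> A B [S [e [fS sS e0 SA]]] [S' [e' [fS' sS' e'0 SB]]].
  exists (S `|` S'), (Num.min e e'); split.
  + by rewrite finite_setU.
  + by move=> f [/sS|/sS'].
  + by rewrite lt_min e0.
  + move=> nu H; split; [apply: SA|apply: SB] => f Sf.
      by have := H f (or_introl Sf); rewrite lt_min => /andP[].
    by have := H f (or_intror Sf); rewrite lt_min => /andP[].
- move=> A B AB [S [e [fS sS e0 SA]]].
  by exists S, e; split => //; exact: subset_trans AB.
Qed.

Let weak_nbhs_singleton (mu : RMb) (A : set RMb) : nbhs mu A -> A mu.
Proof.
by move=> [S [e [_ _ e0 SA]]]; apply: SA => f _; rewrite subrr normr0.
Qed.

Let weak_nbhs_nbhs (mu : RMb) (A : set RMb) :
  nbhs mu A -> nbhs mu (nbhs^~ A).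
Proof.
move=> [S [e [fS sS e0 SA]]].
have e20 : 0 < e / 2 by rewrite divr_gt0.
exists S, (e / 2); split => // nu munu.
exists S, (e / 2); split => // la nula.
apply: SA => f Sf; rewrite [e]splitr.
rewrite -(subrKA (charge_integral nu f)).
by rewrite (le_lt_trans (ler_normD _ _))// ltrD//; [exact: nula|exact: munu].
Qed.

HB.instance Definition _ := Nbhs_isNbhsTopological.Build RMb
  weak_nbhs_filter weak_nbhs_singleton weak_nbhs_nbhs.

End weak_topology.

(* Main.v *)
(* An ultrafilter on M gives, by passing to the limit in mu_+(A) and mu_-(A)
   for each Borel set A, two finitely additive nonnegative set functions on the
   Borel sets.  Condition (alpha) survives in the limit and makes them tight on
   open sets by compact sets.  For such a content l, the outer measure
   A |-> inf {l U | U open, A c U} restricts, by Caratheodory's theorem, to a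
   finite Radon measure that agrees with l on every set squeezed between closed
   and open sets, in particular on the algebra generated by the open sets.  The
   difference of the two measures is the limit: symmetrizable functions are
   uniform limits of step functions over that algebra, and (beta) controls the
   error.  Working with mu_+ and mu_- separately avoids a Jordan decomposition
   for finitely additive set functions.  The passage from M to its closure uses
   only the regularity of the weak topology. *)
Require Import Defs.
From HB Require Import structures.
From mathcomp Require Import all_boot all_order all_algebra.
From mathcomp Require Import all_classical all_reals all_analysis.
From mathcomp Require Import measurable_realfun ring lra.

Set Implicit Arguments.
Unset Strict Implicit.
Unset Printing Implicit Defensive.

Import Order.TTheory GRing.Theory Num.Theory.
Import numFieldNormedType.Exports.

Local Open Scope classical_set_scope.
Local Open Scope ring_scope.

(** * From tight contents to Radon measures *)

Section borel_sets.
Context (T : ptopologicalType).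
Implicit Types A : set T.
Local Notation bset := (@measurable _ (borel T)).

Lemma open_borel A : open A -> bset A.
Proof. exact: sub_sigma_algebra. Qed.

Lemma closed_borel A : closed A -> bset A.
Proof.
move=> cA; rewrite -(setCK A); apply: (@measurableC _ (borel T)).
by apply: open_borel; rewrite openC.
Qed.

Lemma compact_borel A : hausdorff_space T -> compact A -> bset A.
Proof. by move=> hT cA; apply: closed_borel; exact: compact_closed. Qed.

End borel_sets.

Section tight_content.
Context (R : realType) (T : ptopologicalType).
Implicit Types (l : set T -> R) (A B : set T).
Local Notation bset := (@measurable _ (borel T)).

(** Only finite additivity is asked for, since it is all that survives a limit along an ultrafilter;
    tightness on open sets makes up for countable additivity. Values of [l] off the Borel sets are
    unconstrained. *)
Record tight_content l : Prop := TightContent {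
  tc_ge0 : forall A, bset A -> 0 <= l A ;
  tc_setU : forall A B, bset A -> bset B -> A `&` B = set0 ->
    l (A `|` B) = l A + l B ;
  tc_tight : forall U e, open U -> 0 < e ->
    exists C, [/\ compact C, C `<=` U & l (U `\` C) <= e] }.

(* Sets squeezed between closed and open sets: on these the outer extension
   of l from the open sets has no choice but to agree with l. *)
Definition squeezed l A := forall e, 0 < e ->
  exists F U, [/\ closed F, open U, F `<=` A, A `<=` U & l (U `\` F) <= e].

Definition open_outer l A : \bar R :=
  ereal_inf [set (l U)%:E | U in [set U | open U /\ A `<=` U]].

Section theory.
Variable l : set T -> R.
Hypotheses (hT : hausdorff_space T) (tl : tight_content l).

Lemma tc_setD A B : bset A -> bset B -> B `<=` A -> l (A `\` B) = l A - l B.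
Proof.
move=> bA bB BA; rewrite -[in l A](setDUK BA) tc_setU//; first by lra.
  exact: measurableD.
by rewrite setDIK.
Qed.

Lemma tc_set0 : l set0 = 0.
Proof.
have := @tc_setD set0 set0 measurable0 measurable0 (fun _ x => x).
by rewrite setD0 subrr.
Qed.

Lemma tc_le A B : bset A -> bset B -> A `<=` B -> l A <= l B.
Proof.
move=> bA bB AB; rewrite -subr_ge0 -tc_setD// (tc_ge0 tl)//.
exact: measurableD.
Qed.

Lemma tc_leU A B : bset A -> bset B -> l (A `|` B) <= l A + l B.
Proof.
move=> bA bB; have bBA := measurableD bB bA.
rewrite (_ : A `|` B = A `|` (B `\` A)) ?tc_setU// ?setDIK//.
  by rewrite lerD2l; apply: tc_le => // x [].
by rewrite setUDr setDv setD0.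
Qed.

Lemma open_outerE U : open U -> open_outer l U = (l U)%:E.
Proof.
move=> oU; apply/eqP; rewrite eq_le; apply/andP; split.
  by apply: ereal_inf_lbound; exists U => //; split.
apply: le_ereal_inf_tmp => _ [V [oV UV] <-]; rewrite lee_fin.
by apply: tc_le => //; exact: open_borel.
Qed.

Lemma le_open_outer A B : A `<=` B -> (open_outer l A <= open_outer l B)%E.
Proof.
move=> AB; apply: le_ereal_inf_tmp => _ [V [oV BV] <-].
by apply: ereal_inf_lbound; exists V => //; split => //; exact: subset_trans BV.
Qed.

Lemma open_outer_ge0 A : (0 <= open_outer l A)%E.
Proof.
apply: le_ereal_inf_tmp => _ [V [oV _] <-]; rewrite lee_fin (tc_ge0 tl)//.
exact: open_borel.
Qed.

Lemma open_outer_fin A : open_outer l A \is a fin_num.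
Proof.
rewrite ge0_fin_numE ?open_outer_ge0//.
apply: (@le_lt_trans _ _ (l setT)%:E); last exact: ltry.
by rewrite -open_outerE; [exact: le_open_outer|exact: openT].
Qed.

Lemma open_outer0 : open_outer l set0 = 0%E.
Proof. by rewrite open_outerE ?tc_set0//; exact: open0. Qed.

Lemma open_outer_adherent A e : 0 < e ->
  exists U, [/\ open U, A `<=` U & ((l U)%:E <= open_outer l A + e%:E)%E].
Proof.
move=> e0; have [_ [U [oU AU] <-] /ltW UA] :=
  lb_ereal_inf_adherent e0 (open_outer_fin A).
by exists U.
Qed.

(** Compactness replaces countable additivity: up to [e] the union is a compact set, which finitely
    many of the [U n] cover, and finite subadditivity does the rest. *)
Lemma tc_bigcup_open (U : (set T)^nat) : (forall n, open (U n)) ->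
  ((l (\bigcup_n U n))%:E <= \sum_(n <oo) (l (U n))%:E)%E.
Proof.
move=> oU; apply/lee_addgt0Pr => e e0.
have oUU : open (\bigcup_n U n) by exact: bigcup_open.
have [C [cC CU Ce]] := tc_tight tl oUU e0.
have [N _ CN] : \forall n \near \oo, C `<=` \big[setU/set0]_(i < n) U i.
  (* Finite subcover in filter form: near a point of [U k], every partial union with more than [k]
     terms contains the neighbours. *)
  apply: (compact_near_coveringP C).1 => // x /CU [k _ Ukx].
  exists (U k, [set n | (k < n)%N]) => /=.
    by split; [exact: open_nbhs_nbhs|exists k.+1].
  by move=> [y n]/= [Uky kn]; rewrite -bigcup_mkord; exists k.
have sub n : l (\big[setU/set0]_(i < n) U i) <= \sum_(i < n) l (U i).
  elim: n => [|n ih]; first by rewrite !big_ord0 tc_set0.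
  rewrite !big_ord_recr/= (le_trans (tc_leU _ _))//; last by rewrite lerD2r.
    by apply: bigsetU_measurable => i _; exact: open_borel.
  exact: open_borel.
have bC := compact_borel hT cC.
apply: (@le_trans _ _ (\sum_(i < N) l (U i) + e)%:E).
  rewrite lee_fin -(setDUK CU) (le_trans (tc_leU _ _))//.
    by apply: measurableD => //; exact: open_borel.
  rewrite lerD// (le_trans _ (sub N))//; apply: tc_le => //.
    by apply: bigsetU_measurable => i _; exact: open_borel.
  exact: CN (leqnn N).
rewrite EFinD leeD2r// -sumEFin -(big_mkord xpredT (fun i => (l (U i))%:E)).
apply: nneseries_lim_ge => n _ _; rewrite lee_fin (tc_ge0 tl)//.
exact: open_borel.
Qed.

Lemma open_outer_sigma_subadditive : sigma_subadditive (open_outer l).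
Proof.
move=> F; apply/lee_addgt0Pr => e e0.
apply: (le_trans _ (epsilon_trick xpredT _ (ltW e0))); last first.
  by move=> n; exact: open_outer_ge0.
(* The tolerances e / 2^(n+1) sum to [e]. *)
have /choice[U HU] : forall n, exists V, [/\ open V, F n `<=` V &
    ((l V)%:E <= open_outer l (F n) + (e / (2 ^ n.+1)%:R)%:E)%E].
  by move=> n; apply: open_outer_adherent; rewrite divr_gt0// ltr0n expn_gt0.
apply: (@le_trans _ _ (l (\bigcup_n U n))%:E).
  rewrite -open_outerE; last by apply: bigcup_open => n; have [] := HU n.
  apply: le_open_outer => x [n _ Fx]; exists n => //.
  by have [_ + _] := HU n; apply.
apply: le_trans (tc_bigcup_open _) _; first by move=> n; have [] := HU n.
apply: lee_nneseries => n _ //; last by have [] := HU n.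
by rewrite lee_fin (tc_ge0 tl)//; apply: open_borel; have [] := HU n.
Qed.

(** Take [V] open around [X], nearly optimal, and [C] compact filling [V] ∩ [U] up to e/2. Then [V]
    ∩ [U] and [V] \ [C] are open, cover the two halves of [X], and their contents add up to at most
    [l V] + e/2. *)
Lemma caratheodory_open U : open U -> (open_outer l).-caratheodory U.
Proof.
move=> oU X; pose mu : {outer_measure set T -> \bar R} :=
  HB.pack (open_outer l) (isOuterMeasure.Build R T (open_outer l)
    open_outer0 open_outer_ge0 le_open_outer open_outer_sigma_subadditive).
apply: (@le_caratheodory_measurable _ _ mu) => {}X; apply/lee_addgt0Pr => e e0.
have e20 : 0 < e / 2 by rewrite divr_gt0.
have [V [oV XV lV]] := open_outer_adherent X e20.
have oVU : open (V `&` U) by exact: openI.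
have [C [cC CVU Ce]] := tc_tight tl oVU e20.
have bC := compact_borel hT cC.
have bV := open_borel oV; have bVU := open_borel oVU.
have CV : C `<=` V by move=> x /CVU[].
(* [V] \ [U] need not be open; removing the smaller set [C] instead gives an open superset of it. *)
have oVC : open (V `\` C).
  by rewrite setDE; apply: openI => //; apply: closed_openC; exact: compact_closed.
have h1 : (mu (X `&` U) <= (l (V `&` U))%:E)%E.
  by rewrite -open_outerE//; apply: le_open_outer; exact: setSI.
have h2 : (mu (X `&` ~` U) <= (l (V `\` C))%:E)%E.
  rewrite -open_outerE//; apply: le_open_outer => x [Xx Ux].
  by split; [exact: XV|move=> /CVU[]].
apply: (le_trans (leeD h1 h2)).
move: lV; rewrite -[mu X]/(open_outer l X) -(fineK (open_outer_fin X)).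
rewrite -!EFinD !lee_fin.
move: Ce; rewrite !tc_setD//.
lra.
Qed.

Lemma open_outer_measure : exists m : {finite_measure set (borel T) -> \bar R},
  forall A, m A = open_outer l A.
Proof.
pose mu : {outer_measure set T -> \bar R} :=
  HB.pack (open_outer l) (isOuterMeasure.Build R T (open_outer l)
    open_outer0 open_outer_ge0 le_open_outer open_outer_sigma_subadditive).
(* The Caratheodory sets form a sigma-algebra containing the open sets, hence all Borel sets. *)
have sub : bset `<=` mu.-caratheodory.
  apply: smallest_sub; last exact: caratheodory_open.
  split.
  - exact: caratheodory_measurable_set0.
  - by move=> A mA; rewrite setTD; exact: caratheodory_measurable_setC.
  - by move=> F mF; exact: caratheodory_measurable_bigcup.
pose nu : set (borel T) -> \bar R := open_outer l.
have nu_sigma : semi_sigma_additive nu.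
  move=> F mF tF mUF.
  apply: (@measure_semi_sigma_additive _ (caratheodory_type mu) R mu F) => //.
    by move=> i; exact: sub.
  exact: sub.
pose nuM := isMeasure.Build _ (borel T) R nu open_outer0 open_outer_ge0 nu_sigma.
pose m0 : {measure set (borel T) -> \bar R} := HB.pack nu nuM.
have fin : fin_num_fun m0 by move=> A _; exact: open_outer_fin.
pose m : {finite_measure set (borel T) -> \bar R} :=
  HB.pack nu (Measure_isFinite.Build _ _ _ m0 fin) nuM.
by exists m.
Qed.

(** The measure agrees with [l] on open sets, by complements on closed sets, and so on any set
    squeezed between the two. *)
Lemma tight_content_extension :
  exists m : {finite_measure set (borel T) -> \bar R},
    (forall A, bset A -> squeezed l A -> m A = (l A)%:E) /\
    (forall B e, bset B -> 0 < e ->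
      exists C, [/\ compact C, C `<=` B & (m (B `\` C) <= e%:E)%E]).
Proof.
have [m mE] := open_outer_measure; exists m.
have mo U : open U -> m U = (l U)%:E by move=> oU; rewrite mE open_outerE.
have mle A B : bset A -> bset B -> A `<=` B -> (m A <= m B)%E.
  by move=> bA bB AB; apply: le_measure => //; rewrite inE.
have mD A B : bset A -> bset B -> B `<=` A ->
    (m (A `\` B) = m A - m B)%E.
  move=> bA bB BA; rewrite measureD//; first by rewrite setIidr.
  by rewrite ltey_eq fin_num_measure.
have mc F : closed F -> m F = (l F)%:E.
  move=> cF; have bF := closed_borel cF.
  have bT : bset setT by exact: measurableT.
  have bCF : bset (~` F) by exact: measurableC.
  rewrite -(setCK F) -setTD mD// tc_setD// !mo//; first exact: closed_openC.
  exact: openT.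
split=> [A bA sA|B e bB e0].
  apply/eqP; rewrite eq_le; apply/andP; split; apply/lee_addgt0Pr => e e0;
    have [F [U [cF oU FA AU UFe]]] := sA e e0;
    have bF := closed_borel cF; have bU := open_borel oU.
    rewrite (le_trans (mle _ _ bA bU AU))// mo// -EFinD lee_fin.
    have := tc_le bF bA FA; move: UFe.
    by rewrite tc_setD//; [lra|exact: subset_trans AU].
  apply: (@le_trans _ _ (m F + e%:E)%E); last by rewrite leeD2r// mle.
  rewrite mc// -EFinD lee_fin.
  have := tc_le bA bU AU; move: UFe.
  by rewrite tc_setD//; [lra|exact: subset_trans AU].
have e20 : 0 < e / 2 by rewrite divr_gt0.
have [K [cK _ Ke]] := tc_tight tl (@openT T) e20.
have bCB : bset (~` B) by exact: measurableC.
have [U [oU BU Ue]] := open_outer_adherent (~` B) e20.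
have bU := open_borel oU; have bK := compact_borel hT cK.
(* [K] nearly exhausts the space and [U] is a nearly optimal open set around the complement of [B].
   What [K] \ [U] misses of [B] lies outside [K] or in [U] ∩ [B], each of measure at most e/2. *)
exists (K `\` U); split.
- by rewrite setDE; apply: compact_closedI => //; exact: open_closedC.
- by move=> x [_ Ux]; apply: contrapT => /BU.
have bKU : bset (K `\` U) by exact: measurableD.
have bTK : bset (setT `\` K) by apply: measurableD => //; exact: measurableT.
have bUB : bset (U `\` ~` B) by exact: measurableD.
apply: (@le_trans _ _ (m ((setT `\` K) `|` (U `\` ~` B)))).
  apply: mle; [exact: measurableD|exact: measurableU|].
  move=> x [Bx KUx]; have [Ux|nUx] := pselect (U x); [right|left]; split => //.
  by move=> Kx; apply: KUx.
have mU : (m ((setT `\` K) `|` (U `\` ~` B)) <=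
    m (setT `\` K) + m (U `\` ~` B))%E by exact: measureU2.
apply: (le_trans mU); rewrite [e]splitr EFinD leeD//.
  by rewrite mo ?lee_fin// setTD; apply: closed_openC; exact: compact_closed.
rewrite mD// leeBlDl ?fin_num_measure// mo//.
by rewrite mE.
Qed.

(** * The algebra of squeezed sets *)

Lemma squeezed_setC A : squeezed l A -> squeezed l (~` A).
Proof.
move=> sA e /sA[F [U [cF oU FA AU UFe]]]; exists (~` U), (~` F); split.
- exact: open_closedC.
- exact: closed_openC.
- exact: subsetC.
- exact: subsetC.
- by rewrite setDE setCK setIC -setDE.
Qed.

Lemma squeezed_setI A B : squeezed l A -> squeezed l B -> squeezed l (A `&` B).
Proof.
move=> sA sB e e0; have e20 : 0 < e / 2 by rewrite divr_gt0.
have [F [U [cF oU FA AU UFe]]] := sA _ e20.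
have [F' [U' [cF' oU' FB BU UFe']]] := sB _ e20.
exists (F `&` F'), (U `&` U'); split.
- exact: closedI.
- exact: openI.
- exact: setISS.
- exact: setISS.
have bF := closed_borel cF; have bF' := closed_borel cF'.
have bU := open_borel oU; have bU' := open_borel oU'.
have bUF : bset (U `\` F) by exact: measurableD.
have bUF' : bset (U' `\` F') by exact: measurableD.
rewrite [e]splitr (le_trans _ (lerD UFe UFe'))//.
rewrite (le_trans _ (tc_leU bUF bUF'))//; apply: tc_le.
- by apply: measurableD; exact: measurableI.
- exact: measurableU.
move=> x [[Ux U'x] FFx].
have [Fx|nFx] := pselect (F x); [right|left]; split => //.
by move=> F'x; apply: FFx.
Qed.

(** The compact set given by tightness is closed in a Hausdorff space. With the two closure
    properties above, the whole algebra generated by the open sets is squeezed. *)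
Lemma squeezed_open U : open U -> squeezed l U.
Proof.
move=> oU e e0; have [C [cC CU Ce]] := tc_tight tl oU e0.
by exists C, U; split => //; exact: compact_closed.
Qed.

End theory.
End tight_content.

(** * Step functions *)

(** The finite cover is made disjoint and [f] is frozen at one point of each piece. [P] is any
    algebra containing the open sets: the Borel sets give measurability of [f], the squeezed sets
    give convergence of integrals. *)
Lemma symmetrizable_step (R : realType) (T : ptopologicalType)
    (P : set (set T)) (f : T -> R) (e : R) :
  @open T `<=` P -> setC_closed P -> setI_closed P ->
  symmetrizable f -> 0 < e ->
  exists (n : nat) (E : 'I_n -> set T) (c : 'I_n -> R),
    (forall i, P (E i)) /\
    (forall x, `|f x - \sum_(i < n) c i * \1_(E i) x| <= e).
Proof.
move=> oP PC PI sf e0; have [n [G [F [oG cF GF osc]]]] := sf e e0.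
pose K i := G i `&` F i.
have PK i : P (K i).
  apply: PI; first exact/oP/oG.
  by rewrite -(setCK (F i)); apply/PC/oP; rewrite openC.
pose E i := K i `&` \big[setI/setT]_(j < n | (j < i)%N) ~` K j.
have EP i x : E i x <-> K i x /\ forall j : 'I_n, (j < i)%N -> ~ K j x.
  rewrite /E -bigcap_seq_cond; split=> [[Kix Kjx]|[Kix Kjx]]; split => // j.
    by move=> ji; apply: Kjx; rewrite /= mem_index_enum.
  by move=> /= /andP[_ ji]; exact: Kjx.
(* The value is taken at a point of [K i], which may lie outside [E i]; the oscillation bound on
   [K i] covers it. If [K i] is empty the default value of [get] is harmless. *)
exists n, E, (fun i => f (get (K i))); split.
  move=> i; apply: (PI) => //; elim/big_ind : _ => [|A B PA PB|j _].
  - exact/oP/openT.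
  - exact: PI.
  - exact: PC.
move=> x.
have [i0 _ Ki0x] : (\bigcup_i K i) x by rewrite GF.
have Ki0xb : `[< K i0 x >] by apply/asboolP.
(* The least [i] with [x] in [K i] is the only index with [x] in [E i], so one term of the sum
   survives. *)
case: (@arg_minnP _ i0 (fun i => `[< K i x >]) (@nat_of_ord n) Ki0xb) => i /asboolP Kix imin.
have Eix : E i x.
  apply/EP; split => // j ji /asboolP /imin; by rewrite leqNgt ji.
rewrite (bigD1 i)//= big1 ?addr0.
  rewrite indicE mem_set// mulr1 -lee_fin (le_trans _ (ltW (osc i)))//.
  apply: ereal_sup_ubound; exists x => //.
  by exists (get (K i)) => //; apply: (@getPex _ (K i)); exists x.
move=> j ji; rewrite indicE memNset ?mulr0// => /EP[Kjx Kij].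
move: ji; rewrite neq_ltn => /orP[ji|]; last by move/Kij.
by move/asboolP : Kjx => /imin; rewrite leqNgt ji.
Qed.

(** * Integrals and uniform approximation by step functions *)

Section step_integral.
Context (R : realType) d (X : measurableType d).

Lemma measurable_step n (E : 'I_n -> set X) (c : 'I_n -> R) :
  (forall i, measurable (E i)) ->
  measurable_fun setT (fun x => \sum_(i < n) c i * \1_(E i) x).
Proof.
by move=> mE; apply: measurable_sum => i; apply: measurable_funM.
Qed.

Lemma measurable_fun_step_approx (f : X -> R) :
  (forall e, 0 < e -> exists (n : nat) (E : 'I_n -> set X) (c : 'I_n -> R),
    (forall i, measurable (E i)) /\
    (forall x, `|f x - \sum_(i < n) c i * \1_(E i) x| <= e)) ->
  measurable_fun setT f.
Proof.
move=> fE.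
have /choice[h hP] : forall k : nat, exists h : X -> R,
    measurable_fun setT h /\ forall x, `|f x - h x| <= k.+1%:R^-1.
  move=> k; have [|n [E [c [mE fEk]]]] := fE k.+1%:R^-1; first by [].
  exists (fun x => \sum_(i < n) c i * \1_(E i) x); split => //.
  exact: measurable_step.
apply: (@measurable_fun_cvg _ _ _ setT h) => [k|x _]; first by case: (hP k).
apply/cvgrPdist_le => e e0.
near=> k; apply: (le_trans ((hP k).2 x)).
apply: ltW; near: k; exact: (near_infty_natSinv_lt (PosNum e0)).
Unshelve. all: by end_near. Qed.

Lemma Rintegral_step_approx (m : {finite_measure set X -> \bar R})
    n (E : 'I_n -> set X) (c : 'I_n -> R) (f : X -> R) (e : R) :
  (forall i, measurable (E i)) -> measurable_fun setT f ->
  (forall x, `|f x - \sum_(i < n) c i * \1_(E i) x| <= e) ->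
  `|\int[m]_x f x - \sum_(i < n) c i * fine (m (E i))| <= e * fine (m setT).
Proof.
move=> mE mf fg; set g := fun x => \sum_(i < n) c i * \1_(E i) x.
have mg : measurable_fun setT g by exact: measurable_step.
have icE i : m.-integrable setT (fun x => (c i * \1_(E i) x)%:E).
  under eq_fun do rewrite EFinM.
  by apply: integrableZl => //; exact: integrable_indic.
have gE : EFin \o g = fun x => (\sum_(i < n) (c i * \1_(E i) x)%:E)%E.
  by apply/funext => x; rewrite /= sumEFin.
have ig : m.-integrable setT (EFin \o g) by rewrite gE; exact: integrable_sum.
have ie : m.-integrable setT (EFin \o cst e).
  exact: finite_measure_integrable_cst.
(* The difference is dominated by the constant [e], which is integrable for a finite measure;
   integrability of [f] itself is not presupposed. *)
have ih : m.-integrable setT (EFin \o (f \- g)).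
  apply: (le_integrable _ _ _ ie) => //=.
    by apply/measurable_EFinP; exact: measurable_funB.
  by move=> x _; rewrite lee_fin (le_trans (fg x))// ler_norm.
have -> : \int[m]_x f x = \int[m]_x g x + \int[m]_x (f \- g) x.
  by rewrite -RintegralD//; apply: eq_Rintegral => x _; rewrite /= subrKC.
have -> : \int[m]_x g x = \sum_(i < n) c i * fine (m (E i)).
  rewrite /Rintegral -[X in integral _ _ X]/(EFin \o g) gE integral_sum//.
  rewrite (eq_bigr (fun i => (c i * fine (m (E i)))%:E)) ?sumEFin// => i _.
  under eq_integral do rewrite EFinM.
  rewrite integralZl//; last exact: integrable_indic.
  by rewrite integral_indic// setIT EFinM fineK// fin_num_measure.
rewrite addrAC subrr add0r (le_trans (le_normr_Rintegral _ _))//.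
rewrite -Rintegral_cst//; apply: le_Rintegral => //.
  exact: integrable_norm.
by move=> x _; exact: fg.
Qed.

End step_integral.

Lemma charge_tvE (R : realType) d (X : measurableType d)
    (mu : {charge set X -> \bar R}) A :
  charge_tv mu A = (charge_pos mu A + charge_neg mu A)%E.
Proof. by []. Qed.

Section charge_step.
Context (R : realType) d (X : measurableType d) (mu : {charge set X -> \bar R}).

Lemma charge_jordan A : measurable A ->
  fine (mu A) = fine (charge_pos mu A) - fine (charge_neg mu A).
Proof.
move=> mA; have pf := @fin_num_measure _ _ _ (jordan_pos (mu_hahn mu)) A mA.
have nf := @fin_num_measure _ _ _ (jordan_neg (mu_hahn mu)) A mA.
by rewrite (jordan_decomp (mu_hahn mu) mA) /cadd/= cscaleN1 fineB.
Qed.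

(** The errors for the two Jordan parts add up to [e] times the total variation of the space. *)
Lemma charge_integral_step_approx n (E : 'I_n -> set X) (c : 'I_n -> R)
    (f : X -> R) (e : R) :
  (forall i, measurable (E i)) -> measurable_fun setT f ->
  (forall x, `|f x - \sum_(i < n) c i * \1_(E i) x| <= e) ->
  `|charge_integral mu f - \sum_(i < n) c i * fine (mu (E i))| <=
    e * fine (charge_tv mu setT).
Proof.
move=> mE mf fg.
have P := Rintegral_step_approx (jordan_pos (mu_hahn mu)) mE mf fg.
have N := Rintegral_step_approx (jordan_neg (mu_hahn mu)) mE mf fg.
have pf := @fin_num_measure _ _ _ (jordan_pos (mu_hahn mu)) _ (@measurableT _ X).
have nf := @fin_num_measure _ _ _ (jordan_neg (mu_hahn mu)) _ (@measurableT _ X).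
rewrite (eq_bigr (fun i => c i * fine (charge_pos mu (E i)) -
  c i * fine (charge_neg mu (E i)))); last first.
  by move=> i _; rewrite charge_jordan// mulrBr.
rewrite sumrB /charge_integral charge_tvE fineD// mulrDr.
rewrite (le_trans _ (lerD P N))// (le_trans _ (ler_normB _ _))//.
by rewrite le_eqVlt; apply/orP; left; apply/eqP; congr (`|_|); ring.
Qed.
End charge_step.

(** * Limits along ultrafilters *)

(** A segment is compact, so the image filter has a cluster point, and for an ultrafilter a cluster
    point is a limit. *)
Lemma ultra_bounded_cvg (R : realType) (I : Type) (U : set_system I)
    (h : I -> R) (a b : R) :
  UltraFilter U -> (\forall i \near U, a <= h i <= b) -> cvg (h i @[i --> U]).
Proof.
move=> UU hab; have UP := ultra_proper.
have [|p [_ clp]] := @segment_compact R a b (h @ U) _.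
  by apply: filterS hab => i /=; rewrite in_itv.
apply/cvg_ex; exists p => B Bp.
have [//|nB] := in_ultra_setVsetC (h @^-1` B) UU.
have [x [nBx Bx]] := clp (~` B) B nB Bp.
by exfalso; exact: nBx.
Qed.

Section ultra_limit.
Context (R : realType) (T : ptopologicalType) (I : Type) (U : set_system I).
Hypothesis UU : UltraFilter U.
Local Notation bset := (@measurable _ (borel T)).
Variables (q : I -> {measure set (borel T) -> \bar R}) (b : R).
Hypothesis qb : \forall i \near U, (q i setT <= b%:E)%E.
Hypothesis qtight : forall (G : set T) e, open G -> 0 < e ->
  exists C, [/\ compact C, C `<=` G &
    \forall i \near U, (q i (G `\` C) <= e%:E)%E].

(** Boundedness gives a limit on each Borel set; additivity passes to the limit, and so does the
    bound on [G] \ [C], with the same compact [C]. *)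
Lemma ultra_limit_tight_content : hausdorff_space T ->
  exists l : set T -> R, tight_content l /\
    forall A, bset A -> fine (q i A) @[i --> U] --> l A.
Proof.
move=> hT; have UP := @ultra_proper _ _ UU.
have qb' A : bset A -> \forall i \near U, q i A \is a fin_num /\
    0 <= fine (q i A) <= b.
  move=> bA; apply: filterS qb => i qib.
  have qAb : (q i A <= b%:E)%E.
    by apply: le_trans qib; apply: le_measure => //; rewrite inE//.
  have fA : q i A \is a fin_num.
    by rewrite ge0_fin_numE// (le_lt_trans qAb)// ltry.
  by split => //; rewrite fine_ge0//= -lee_fin fineK.
have qcvg A : bset A -> cvg (fine (q i A) @[i --> U]).
  move=> bA; apply: (@ultra_bounded_cvg _ _ _ _ 0 b) => //.
  by apply: filterS (qb' A bA) => i [].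
exists (fun A => lim (fine (q i A) @[i --> U])); split; last exact: qcvg.
split.
- move=> A bA; apply: limr_ge; first exact: qcvg.
  by apply: filterS (qb' A bA) => i [_ /andP[]].
- move=> A B bA bB AB0.
  apply/cvg_lim => //; apply: cvg_trans; last exact: cvgD (qcvg A bA) (qcvg B bB).
  apply: near_eq_cvg; near=> i.
  have [fA _] : q i A \is a fin_num /\ 0 <= fine (q i A) <= b.
    by near: i; exact: qb'.
  have [fB _] : q i B \is a fin_num /\ 0 <= fine (q i B) <= b.
    by near: i; exact: qb'.
  by rewrite measureU// fineD.
- move=> G e oG e0; have [C [cC CG qe]] := qtight oG e0.
  exists C; split => //.
  have bGC : bset (G `\` C).
    by apply: measurableD; [exact: open_borel|exact: compact_borel].
  apply: limr_le; first exact: qcvg.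
  near=> i.
  have [fGC _] : q i (G `\` C) \is a fin_num /\ 0 <= fine (q i (G `\` C)) <= b.
    by near: i; exact: qb'.
  by rewrite -lee_fin fineK//; near: i.
Unshelve. all: by end_near. Qed.

End ultra_limit.

(** * The limit measure and convergence of integrals *)

Lemma radon_of_tight_contents (R : realType) (T : ptopologicalType)
    (l1 l2 : set T -> R) : hausdorff_space T ->
  tight_content l1 -> tight_content l2 ->
  exists la : bounded_radon_measure R T, forall A : set (borel T), measurable A ->
    squeezed l1 A -> squeezed l2 A -> la A = (l1 A - l2 A)%:E.
Proof.
move=> hT t1 t2.
have [m1 [m1l m1R]] := tight_content_extension hT t1.
have [m2 [m2l m2R]] := tight_content_extension hT t2.
(* [crestr0] puts the value 0 on nonmeasurable sets, as [brm_out] demands. *)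
pose nu : {charge set (borel T) -> \bar R} :=
  crestr0 (cadd (charge_of_finite_measure m1)
    (copp (charge_of_finite_measure m2))) (@measurableT _ (borel T)).
have nuE A : measurable A -> nu A = (m1 A - m2 A)%E.
  by move=> mA; rewrite /nu /= /crestr0 mem_set// /crestr setIT.
have out A : ~ measurable A -> nu A = 0%E.
  by move=> mA; rewrite /nu /= /crestr0 memNset.
have radon (B : set (borel T)) (e : R) : measurable B -> 0 < e ->
  exists C : set T, [/\ compact C, C `<=` B & (`|nu B - nu C| < e%:E)%E].
  move=> bB e0; have e30 : 0 < e / 3 by rewrite divr_gt0.
  have [C1 [cC1 C1B C1e]] := m1R B _ bB e30.
  have [C2 [cC2 C2B C2e]] := m2R B _ bB e30.
  have bC1 := compact_borel hT cC1; have bC2 := compact_borel hT cC2.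
  (* One compact set serves both measures, because enlarging it inside [B] only shrinks the
     remainder. Both errors lie between 0 and e/3, and so their difference is below [e] in absolute
     value. *)
  pose C := C1 `|` C2.
  have bC : @measurable _ (borel T) C by exact: measurableU.
  have CB : C `<=` B by move=> x [/C1B|/C2B].
  exists C; split => //; first exact: compactU.
  have mD (m : {finite_measure set (borel T) -> \bar R}) (D : set (borel T)) :
      measurable D -> D `<=` C -> (m (B `\` D) <= (e / 3)%:E)%E ->
      0 <= fine (m B) - fine (m C) <= e / 3.
    move=> bD DC mDe.
    have bBC : @measurable _ (borel T) (B `\` C) by exact: measurableD.
    have : (m (B `\` C) <= (e / 3)%:E)%E.
      apply: le_trans mDe; apply: le_measure; rewrite ?inE//.
        exact: measurableD.
      exact: setDS.
    have : (0 <= m (B `\` C))%E by [].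
    have -> : m (B `\` C) = (fine (m B) - fine (m C))%:E.
      rewrite measureD//; last by rewrite ltey_eq fin_num_measure.
      by rewrite setIidr// EFinB !fineK// fin_num_measure.
    by rewrite !lee_fin => -> ->.
  have C1C : C1 `<=` C by left.
  have C2C : C2 `<=` C by right.
  have := mD m1 C1 bC1 C1C C1e; have := mD m2 C2 bC2 C2C C2e.
  rewrite !nuE//.
  rewrite -(fineK (fin_num_measure m1 _ bB)) -(fineK (fin_num_measure m2 _ bB)).
  rewrite -(fineK (fin_num_measure m1 _ bC)) -(fineK (fin_num_measure m2 _ bC)).
  rewrite -!EFinB/= lte_fin => /andP[? ?] /andP[? ?].
  by rewrite ltr_norml; apply/andP; split; lra.
exists (BRM out radon) => A bA s1 s2.
by rewrite -[LHS]/(nu A) nuE// m1l// m2l.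
Qed.

Section weak_limit.
Context (R : realType) (T : ptopologicalType).
Local Notation bset := (@measurable _ (borel T)).
Local Notation RMb := (bounded_radon_measure R T).

Lemma symmetrizable_measurable (f : T -> R) :
  symmetrizable f -> measurable_fun setT (f : borel T -> R).
Proof.
move=> sf; apply: measurable_fun_step_approx => e e0.
apply: (@symmetrizable_step _ _ bset) => //.
- exact: open_borel.
- by move=> A; exact: measurableC.
- by move=> A B; exact: measurableI.
Qed.

(** [U] and its complement form a cover on whose pieces the indicator is constant. These functions
    are the ones that separate measures. *)
Lemma symmetrizable_open (U : set T) : open U -> symmetrizable (\1_U : T -> R).
Proof.
move=> oU e e0.
exists 2, (fun i => if i == ord0 then U else setT),
  (fun i => if i == ord0 then setT else ~` U); split.
- by move=> i; case: ifP => // _; exact: openT.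
- by move=> i; case: ifP => // _; exact: open_closedC.
- apply/seteqP; split => // x _; have [Ux|nUx] := pselect (U x).
    by exists ord0.
  by exists ord_max.
- move=> i; apply: le_lt_trans (_ : 0%:E < e%:E)%E; last by rewrite lte_fin.
  apply: ge_ereal_sup => _ [x Kx [y Ky <-]].
  rewrite lee_fin !indicE.
  case: ifPn Kx Ky => i0 [Ux nUx] [Uy nUy].
    by rewrite !mem_set// subrr normr0.
  by rewrite !memNset// subrr normr0.
Qed.

Lemma charge_integral_cvg (U : set_system RMb) (la : RMb) (P : set (set T))
    (b : R) (f : T -> R) :
  ProperFilter U -> @open T `<=` P -> setC_closed P -> setI_closed P ->
  P `<=` bset ->
  (forall A, P A -> fine ((nu : RMb) A) @[nu --> U] --> fine (la A)) ->
  (\forall nu \near U, (charge_tv (nu : RMb) setT <= b%:E)%E) ->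
  symmetrizable f ->
  charge_integral (nu : RMb) f @[nu --> U] --> charge_integral la f.
Proof.
move=> UP oP PC PI Pb Pcvg Ub sf; have mf := symmetrizable_measurable sf.
have tv0 (nu : RMb) : 0 <= fine (charge_tv nu setT).
  by rewrite fine_ge0// charge_tvE adde_ge0.
apply/cvgrPdist_lt => e e0.
pose L := fine (charge_tv la setT).
have L0 : 0 <= L by exact: tv0.
have b0 := normr_ge0 b.
have K0 : 0 < 2 * (`|b| + L + 1) by lra.
(* The two approximation errors, at most [d] times [L] and [d] times |[b]|, together stay below e/2;
   the summand 1 keeps the denominator positive. The step sums contribute the other e/2. *)
pose d := e / (2 * (`|b| + L + 1)).
have d0 : 0 < d by rewrite divr_gt0.
have dE : d * (`|b| + L + 1) = e / 2.
  by rewrite /d; field; rewrite gt_eqF//; lra.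
have [n [E [c [PE fE]]]] := symmetrizable_step oP PC PI sf d0.
have bE i := Pb _ (PE i).
have cvgS : (\sum_(i < n) c i * fine ((nu : RMb) (E i))) @[nu --> U] -->
    \sum_(i < n) c i * fine (la (E i)).
  apply: cvg_big => [|i _]; first exact: add_continuous.
  by apply: cvgMl_tmp; exact: Pcvg.
have e20 : 0 < e / 2 by rewrite divr_gt0.
move/cvgrPdist_lt : cvgS => /(_ _ e20) cvgS.
near=> nu.
have h1 := charge_integral_step_approx la bE mf fE.
have h2 := charge_integral_step_approx nu bE mf fE.
have h3 : `|\sum_(i < n) c i * fine (la (E i)) -
  \sum_(i < n) c i * fine (nu (E i))| < e / 2 by near: nu.
have h4 : fine (charge_tv nu setT) <= `|b|.
  have : (charge_tv nu setT <= b%:E)%E by near: nu.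
  rewrite -{1}[charge_tv nu setT]fineK ?lee_fin; last first.
    by rewrite charge_tvE fin_numD !fin_num_measure.
  by move=> /le_trans; apply; exact: ler_norm.
have h5 : d * fine (charge_tv nu setT) <= d * `|b| by rewrite ler_pM2l.
move: h1 h2 h3 h5 dE; rewrite -/L !mulrDr mulr1.
move: (charge_integral la f) (charge_integral nu f) => x y.
move: (\sum_(i < n) _) (\sum_(i < n) _) => s t.
rewrite !ler_norml !ltr_norml => /andP[? ?] /andP[? ?] /andP[? ?] ? ?.
by apply/andP; split; lra.
Unshelve. all: by end_near. Qed.

End weak_limit.

(** * The weak topology *)

Section radon_measure_extensionality.
Context (R : realType) (T : ptopologicalType).
Local Notation RMb := (bounded_radon_measure R T).
Implicit Types mu nu : RMb.

(** By [brm_out] the underlying functions agree on all sets; the other fields are proofs, equal by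
    proof irrelevance. *)
Lemma brm_eq mu nu :
  (forall A : set (borel T), measurable A -> mu A = nu A) -> mu = nu.
Proof.
move=> eqA; have eqf : (mu : set (borel T) -> \bar R) = nu.
  apply/funext => A; have [mA|nA] := pselect (measurable A); first exact: eqA.
  by rewrite !brm_out.
move: mu nu eqf {eqA} =>
  [[f [[a] [b] [c]]] outf radf] [[g [[a'] [b'] [c']]] outg radg] /= eqf.
subst g; move: a' b' c' outg radg => a' b' c' outg radg.
rewrite (Prop_irrelevance a' a) in outg radg *.
rewrite (Prop_irrelevance b' b) in outg radg *.
rewrite (Prop_irrelevance c' c) in outg radg *.
by rewrite (Prop_irrelevance outg outf) (Prop_irrelevance radg radf).
Qed.

(** The Borel sets of agreement form a Dynkin system, and the open sets are stable under
    intersection. *)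
Lemma brm_eq_open mu nu : (forall U : set T, open U -> mu U = nu U) -> mu = nu.
Proof.
move=> eqU; apply: brm_eq.
pose D := [set A : set (borel T) | measurable A /\ mu A = nu A].
suff: <<s @open T >> `<=` D by move=> sD A /sD[].
rewrite -setI_closed_g_dynkin_g_sigma_algebra; last by move=> A B; exact: openI.
have muT : mu setT = nu setT by apply: eqU; exact: openT.
apply: smallest_sub; last first.
  by move=> U oU; split; [exact: open_borel|exact: eqU].
split.
- by split; [exact: measurableT|].
- move=> A [mA eqA]; split; first exact: measurableC.
  by rewrite -setTD !chargeD// ?setTI; [rewrite muT eqA|exact: measurableT..].
- move=> F tF DF; have mF n : measurable (F n : set (borel T)) by case: (DF n).
  have mUF : measurable (\bigcup_n F n : set (borel T)) by exact: bigcup_measurable.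
  split => //.
  have cmu := @charge_semi_sigma_additive _ _ _ mu F mF tF mUF.
  have cnu := @charge_semi_sigma_additive _ _ _ nu F mF tF mUF.
  apply: (cvg_unique _ cmu) => //.
  suff -> : (fun n => (\sum_(0 <= i < n) mu (F i))%E) =
            (fun n => (\sum_(0 <= i < n) nu (F i))%E) by [].
  by apply/funext => n; apply: eq_bigr => i _; case: (DF i).
Qed.

Lemma charge_integral_indic_open mu (U : set T) : open U ->
  charge_integral mu \1_U = fine (mu U).
Proof.
move=> oU.
(* The indicator is its own one-term step function, with error 0. *)
have := @charge_integral_step_approx R _ _ mu 1 (fun=> U) (fun=> 1) \1_U 0.
rewrite big_ord_recl big_ord0 addr0 mul1r mul0r => h.
apply/eqP; rewrite -subr_eq0 -normr_le0; apply: h.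
- by move=> _; exact: open_borel.
- by apply: symmetrizable_measurable; exact: symmetrizable_open.
- by move=> x; rewrite big_ord_recl big_ord0 addr0 mul1r subrr normr0.
Qed.

Lemma weak_nbhs_ball mu (S : set (T -> R)) (e : R) : finite_set S ->
  S `<=` @symmetrizable R T -> 0 < e -> nbhs mu (weak_ball mu S e).
Proof. by move=> fS sS e0; exists S, e; split. Qed.

(** If all neighbourhoods of two measures meet, then balls for the indicator of an open set show
    that the measures agree on that set. *)
Lemma weak_hausdorff : hausdorff_space RMb.
Proof.
move=> mu nu clmn; apply: brm_eq_open => U oU.
have bU := open_borel oU.
rewrite -(fineK (fin_num_measure mu _ bU)) -(fineK (fin_num_measure nu _ bU)).
congr (_%:E); rewrite -!charge_integral_indic_open//.
apply/eqP; rewrite -subr_eq0 -normr_le0; apply/ler_addgt0Pr => e e0.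
have e20 : 0 < e / 2 by rewrite divr_gt0.
have s1 : [set \1_U : T -> R] `<=` @symmetrizable R T.
  by move=> _ ->; exact: symmetrizable_open.
have [la [/(_ _ erefl) h1 /(_ _ erefl) h2]] := clmn _ _
  (weak_nbhs_ball mu (finite_set1 _) s1 e20)
  (weak_nbhs_ball nu (finite_set1 _) s1 e20).
rewrite add0r; move: h1 h2.
rewrite ler_norml !ltr_norml => /andP[? ?] /andP[? ?].
by apply/andP; split; lra.
Qed.

End radon_measure_extensionality.

Lemma weak_cvg (R : realType) (T : ptopologicalType)
    (U : set_system (bounded_radon_measure R T))
    (la : bounded_radon_measure R T) : Filter U ->
  (forall f, symmetrizable f ->
    charge_integral (nu : bounded_radon_measure R T) f @[nu --> U] -->
      charge_integral la f) ->
  U --> la.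
Proof.
move=> FU cf A [S [e [/finite_fsetP[S' SE] sS e0 SA]]].
pose D f := [set nu : bounded_radon_measure R T |
  `|charge_integral nu f - charge_integral la f| < e].
have UD : U (\bigcap_(f in S) D f).
  rewrite SE; apply: filter_bigI => f fS'.
  have sf : symmetrizable f by apply: sS; rewrite SE.
  have /cvgrPdist_lt/(_ _ e0) := cf f sf.
  by apply: filterS => nu; rewrite /D /= distrC.
by apply: filterS UD => nu H; apply: SA => f Sf; exact: H.
Qed.

(** * Convergence of ultrafilters on [M] *)

Section main.
Context (R : realType) (T : ptopologicalType).
Local Notation RMb := (bounded_radon_measure R T).
Local Notation bset := (@measurable _ (borel T)).
Hypothesis hT : hausdorff_space T.
Variable M : set RMb.
Hypothesis alpha : forall (G : set T) (e : R), open G -> 0 < e ->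
      exists C : set T, [/\ compact C, C `<=` G &
        forall mu, M mu -> (charge_tv mu (G `\` C) < e%:E)%E].
Hypothesis beta : (ereal_sup [set charge_tv mu setT | mu in M] < +oo)%E.

Lemma ultra_weak_cvg (U : set_system RMb) : UltraFilter U -> U M ->
  exists la : RMb, U --> la.
Proof.
move=> UU UM; have UP := ultra_proper.
have [b Mb] : exists b : R, forall mu, M mu -> (charge_tv mu setT <= b%:E)%E.
  exists (fine (ereal_sup [set charge_tv mu setT | mu in M])) => mu Mmu.
  apply: (@le_trans _ _ (ereal_sup [set charge_tv mu setT | mu in M])).
    by apply: ereal_sup_ubound; exists mu.
  by move: (ereal_sup _) beta => [r||]//= _; rewrite leNye.
have posle (mu : RMb) A : (charge_pos mu A <= charge_tv mu A)%E.
  by rewrite charge_tvE leeDl.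
have negle (mu : RMb) A : (charge_neg mu A <= charge_tv mu A)%E.
  by rewrite charge_tvE leeDr.
(* Stated for any [q] dominated by the total variation, so as to serve for the positive and the
   negative parts alike. *)
have lim (q : RMb -> {measure set (borel T) -> \bar R}) :
    (forall mu A, (q mu A <= charge_tv mu A)%E) ->
    exists l : set T -> R, tight_content l /\
      forall A, bset A -> fine (q mu A) @[mu --> U] --> l A.
  move=> qtv; apply: (@ultra_limit_tight_content R T RMb U UU q b) => //.
    by apply: filterS UM => mu Mmu; rewrite (le_trans (qtv _ _))//; exact: Mb.
  move=> G e oG e0; have [C [cC CG tvC]] := alpha oG e0.
  exists C; split => //; apply: filterS UM => mu Mmu.
  by rewrite (le_trans (qtv _ _))// ltW//; exact: tvC.
have [l1 [t1 c1]] := lim _ posle.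
have [l2 [t2 c2]] := lim _ negle.
have [la laE] := radon_of_tight_contents hT t1 t2.
exists la; apply: weak_cvg => f sf.
(* On this algebra [la] is [l1] - [l2], so there the values of the measures converge to those of
   [la]. *)
pose P := [set A | [/\ bset A, squeezed l1 A & squeezed l2 A]].
apply: (@charge_integral_cvg R T U la P b f) => //.
- by move=> A oA; split; [exact: open_borel|exact: squeezed_open..].
- by move=> A [bA s1 s2]; split; [exact: measurableC|exact: squeezed_setC..].
- move=> A B [bA s1 s2] [bB s1' s2'].
  by split; [exact: measurableI|exact: squeezed_setI..].
- by move=> A [].
- move=> A [bA s1 s2]; rewrite laE//=.
  under eq_cvg do rewrite charge_jordan//.
  by apply: cvgB; [exact: c1|exact: c2].
- by apply: filterS UM => mu; exact: Mb.
Qed.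

End main.

(** * Passage to the closure *)

Lemma weak_open_far (R : realType) (T : ptopologicalType)
    (la : bounded_radon_measure R T) (S : set (T -> R)) (e : R) :
  S `<=` @symmetrizable R T ->
  open [set nu : bounded_radon_measure R T |
    exists2 f, S f & e < `|charge_integral nu f - charge_integral la f|].
Proof.
move=> sS; rewrite openE => nu [f Sf enu].
have d0 : 0 < `|charge_integral nu f - charge_integral la f| - e.
  by rewrite subr_gt0.
have s1 : [set f] `<=` @symmetrizable R T by move=> _ ->; exact: sS.
apply: filterS (weak_nbhs_ball nu (finite_set1 f) s1 d0) => ka /(_ _ erefl) h.
exists f => //.
move: h; rewrite ltrBrDl distrC.
move=> /lt_le_trans/(_ (ler_distD (charge_integral ka f) _ _)).
by rewrite addrC ltrD2l.
Qed.

(* A filter F on cl M is replaced by the traces on M of the open sets of F;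
   regularity makes a limit point of the traces a limit point of F. *)
Lemma weak_closure_compact (R : realType) (T : ptopologicalType)
    (M : set (bounded_radon_measure R T)) :
  (forall U, UltraFilter U -> U M ->
    exists la : bounded_radon_measure R T, U --> la) ->
  compact [set: set_type (closure M)].
Proof.
move=> limM F FP _.
pose RMb := bounded_radon_measure R T.
pose val : set_type (closure M) -> RMb := set_val.
pose G : set_system RMb := filter_from
  [set V : set RMb | open V /\ F (val @^-1` V)] (fun V => V `&` M).
have GP : ProperFilter G.
  apply: filter_from_proper; first apply: filter_from_filter.
  - exists setT; split; [exact: openT|exact: filterT].
  - move=> V W [oV FV] [oW FW]; exists (V `&` W); last by rewrite setIACA setIid.
    by split; [exact: openI|exact: filterI].
  move=> V [oV /filter_ex[x Vx]].
  (* An open set that contains a point of the closure meets [M], so the traces are nonempty. *)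
  have [y [My Vy]] := set_valP x V (open_nbhs_nbhs (conj oV Vx)).
  by exists y.
have [U [UU GU]] := ultraFilterLemma GP; have UP := ultra_proper.
have UM : U M.
  apply: GU; exists setT; last by move=> x [].
  by split; [exact: openT|exact: filterT].
have [la Ula] := limM U UU UM.
have clla : closure M la.
  by move=> B /Ula UB; exact: filter_ex (filterI UM UB).
exists (exist _ la (mem_set clla)); split => // A B FA [_ [[W oW <-] Wla WB]].
have [S [e [fS sS e0 SW]]] : nbhs la W by exact: open_nbhs_nbhs.
apply: contrapT => AB0.
(* If [A] and [B] were disjoint, all of [A] would be at distance at least [e] from [la] for some [f]
   in [S], hence in the open set [V]. Then [U] would contain both [V] and the ball of radius e/2
   around [la], which are disjoint. *)
pose V := [set nu : RMb |
    exists2 f, S f & e / 2 < `|charge_integral nu f - charge_integral la f|].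
have oV : open V by exact: weak_open_far.
have UV : U V.
  apply: GU; exists V; last by move=> x [].
  split => //; apply: filterS FA => x Ax; apply: contrapT => nVx; apply: AB0.
  exists x; split => //; apply: WB; apply: SW => f Sf.
  rewrite ltNge; apply/negP => ef; apply: nVx; exists f => //.
  by apply: lt_le_trans ef; lra.
have e20 : 0 < e / 2 by rewrite divr_gt0.
have UB := Ula _ (weak_nbhs_ball la fS sS e20).
have [nu [[f Sf h1] /(_ f Sf) h2]] := filter_ex (filterI UV UB).
by have := lt_trans h1 h2; rewrite ltxx.
Qed.

Lemma set_type_hausdorff (X : topologicalType) (A : set X) :
  hausdorff_space X -> hausdorff_space (set_type A).
Proof.
move=> hX x y clxy; apply: val_inj; apply: hX => B C Bx Cy.
have [z [Bz Cz]] := clxy _ _ (@initial_continuous _ _ (@set_val _ A) x _ Bx)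
  (@initial_continuous _ _ (@set_val _ A) y _ Cy).
by exists (set_val z).
Qed.

Theorem theorem4 (R : realType) (T : ptopologicalType)
    (hT : hausdorff_space T) (M : set (bounded_radon_measure R T))
    (alpha : forall (G : set T) (e : R), open G -> 0 < e ->
      exists C : set T, [/\ compact C, C `<=` G &
        forall mu, M mu -> (charge_tv mu (G `\` C) < e%:E)%E])
    (beta : (ereal_sup [set charge_tv mu setT | mu in M] < +oo)%E) :
  hausdorff_space (set_type (closure M)) /\
  compact [set: set_type (closure M)].
Proof.
split; first by apply: set_type_hausdorff; exact: weak_hausdorff.
by apply: weak_closure_compact => U; exact: ultra_weak_cvg.
Qed.
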